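(* Let $H$ be a separable complex Hilbert space, let $A\in\mathcal{B}(H)$ and let $N(\cdot)$ be a norm on $\mathcal{B}(H)$. Then $$0\le 2\sup_{\theta\in\mathbb{R}}\int_0^1 N\big((1-\lambda)e^{i\theta}A+\lambda e^{-i\theta}A^*\big)\,d\lambda-\frac12\big(N(A)+N(A^* )\big)\le w_N(A).$$
   Context: $\mathcal{B}(H)$ is the space of bounded linear operators on $H$. For $T\in\mathcal{B}(H)$, $Re(T)=\frac{T+T^*}{2}$. For a norm $N(\cdot)$ on $\mathcal{B}(H)$ (an arbitrary norm on this complex vector space), the generalized numerical radius is $w_N(A)=\sup_{\theta\in\mathbb{R}}N(Re(e^{i\theta}A))$. *)

(* Defs.v *)
From HB Require Import structures.
From mathcomp Require Import all_boot all_order all_algebra.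
From mathcomp Require Import sesquilinear complex.
From mathcomp Require Import all_classical all_reals all_analysis.

Set Implicit Arguments.
Unset Strict Implicit.
Unset Printing Implicit Defensive.

Import Order.TTheory GRing.Theory Num.Theory.
Import numFieldNormedType.Exports.

Local Open Scope classical_set_scope.
Local Open Scope ring_scope.
Local Open Scope complex_scope.

(* The inner product is linear in its first argument and conjugate-linear in
   its second one. *)
HB.mixin Record CompleteNormedModule_isHilbert (R : realType) H
    of CompleteNormedModule R[i] H := {
  inner : {dot H for Num.conj} ;
  sqr_norm_inner : forall x : H, `|x| ^+ 2 = inner x x
}.

#[short(type="hilbertType")]
HB.structure Definition Hilbert (R : realType) :=
  { H of CompleteNormedModule_isHilbert R H & CompleteNormedModule R[i] H }.

Definition separable_space (T : topologicalType) :=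
  exists D : set T, countable D /\ dense D.

Definition expi (R : realType) (t : R) : R[i] := cos t +i* sin t.

Section BoundedOperators.
Variables (R : realType) (H : hilbertType R).

Definition bounded_linear_op : {pred H -> H} :=
  fun f => `[< linear f /\ exists M : R, forall x, `|f x| <= M%:C * `|x| >].

Record bop := Bop { bop_fun :> H -> H ; _ : bop_fun \in bounded_linear_op }.

HB.instance Definition _ := [isSub for bop_fun].
HB.instance Definition _ := [Choice of bop by <:].

Fact bounded_linear_op_submod : submod_closed bounded_linear_op.
Proof.
split=> [|a f g /asboolP[lf [M fM]] /asboolP[lg [M' gM]]].
  apply/asboolP; split=> [b x y|]; first by rewrite scaler0 addr0.
  by exists 0 => x; rewrite normr0 mul0r.
apply/asboolP; split=> [b x y|].
  by rewrite !fctE lf lg !scalerDr !scalerA mulrC addrACA.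
exists (Normc.normc a * M + M') => x.
rewrite rmorphD rmorphM /= mulrDl -mulrA (le_trans (ler_normD _ _))//.
by rewrite lerD// normrZ ler_wpM2l.
Qed.

HB.instance Definition _ :=
  GRing.isSubmodClosed.Build R[i] (H -> H) bounded_linear_op
    bounded_linear_op_submod.

HB.instance Definition _ := [SubChoice_isSubLmodule of bop by <:].

(* Such a B exists, by the Riesz representation theorem, and is unique, so that
   the default value of xget is never used. *)
Definition adjoint (A : bop) : bop :=
  xget 0 [set B : bop | forall x y : H, inner (A x) y = inner x (B y)].

Definition Re_op (T : bop) : bop := 2^-1 *: (T + adjoint T).

(* The values are taken in R and embedded in R[i] for homogeneity;
   nonnegativity follows from the axioms. *)
Definition is_norm (N : bop -> R) :=
  [/\ forall A B, N (A + B) <= N A + N B,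
      forall (a : R[i]) A, (N (a *: A))%:C = `|a| * (N A)%:C
    & forall A, N A = 0 -> A = 0].

(* When N is a norm, the set is nonempty and bounded above by (N A + N (adjoint A)) / 2, so that
   sup is the true supremum. *)
Definition gen_numerical_radius (N : bop -> R) (A : bop) : R :=
  sup (range (fun t : R => N (Re_op (expi t *: A)))).

End BoundedOperators.

(* Main.v *)
(* Write B for the adjoint of A and f_t(l) = N((1 - l) e^(it) A + l e^(-it) B).
   Each f_t is convex, with f_t(0) = N(A), f_t(1) = N(B) and f_t(1/2) =
   N(Re(e^(it) A)) <= w_N(A); the trapezoid bound on [0, 1/2] and [1/2, 1] gives
   the upper estimate.  For the lower one, the triangle inequality yields
   f_0(l) + f_(pi/2)(l) >= 2 max((1 - l) N(A), l N(B)) >= (1 - l) N(A) + l N(B),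
   so that one of the integrals of f_0 and f_(pi/2) is at least
   (N(A) + N(B)) / 4. *)
Require Import Defs.
From HB Require Import structures.
From mathcomp Require Import all_boot all_order all_algebra.
From mathcomp Require Import sesquilinear complex.
From mathcomp Require Import ring lra.
From mathcomp Require Import all_classical all_reals all_analysis.

Set Implicit Arguments.
Unset Strict Implicit.
Unset Printing Implicit Defensive.

Import Order.TTheory GRing.Theory Num.Theory.
Import numFieldNormedType.Exports.

Local Open Scope classical_set_scope.
Local Open Scope ring_scope.
Local Open Scope complex_scope.

(** * Integrals of continuous and convex real functions *)

Section RealIntegrals.
Variable R : realType.
Implicit Types (f : R -> R) (a b p q x : R).

Lemma integrable_itv f a b : continuous f ->
  lebesgue_measure.-integrable `[a, b] (EFin \o f).
Proof.
move=> cf; apply: continuous_compact_integrable; first exact: segment_compact.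
exact: continuous_subspaceT.
Qed.

Lemma continuous_affine p q : continuous (fun x => p + q * x).
Proof.
move=> x; apply: cvgD; first exact: cvg_cst.
by apply: cvgM; [exact: cvg_cst|exact: cvg_id].
Qed.

Lemma Rintegral_affine p q a b : a < b ->
  \int[lebesgue_measure]_(x in `[a, b]) (p + q * x) =
  (b - a) * (p + q * ((a + b) / 2)).
Proof.
move=> ab; pose F x := p * x + q / 2 * x ^+ 2.
have dF x : is_derive x 1 F (p + q * x).
  by apply: is_derive_eq; rewrite /GRing.scale /= mulr1; field.
have cF : continuous F.
  by move=> x; apply/differentiable_continuous/derivable1_diffP.
rewrite /Rintegral (@continuous_FTC2 _ _ F)//=.
- by rewrite /F; field.
- exact/continuous_subspaceT/continuous_affine.
- by split; [|exact/cvg_at_right_filter/cF|exact/cvg_at_left_filter/cF].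
- by move=> x _; rewrite derive1E derive_val.
Qed.

(** The hypothesis is the convexity inequality between [a] and [b], cleared of denominators. It
    places [f] below its chord of slope [q], and the integral of the chord is the length times its
    midpoint value. *)
Lemma Rintegral_trapezoid f a b : a < b -> continuous f ->
  (forall x, a <= x <= b -> (b - a) * f x <= (b - x) * f a + (x - a) * f b) ->
  \int[lebesgue_measure]_(x in `[a, b]) f x <= (b - a) * ((f a + f b) / 2).
Proof.
move=> ab cf convf.
pose q := (f b - f a) / (b - a).
have ba0 : 0 < b - a by rewrite subr_gt0.
rewrite (_ : (f a + f b) / 2 = (f a - q * a) + q * ((a + b) / 2)); last first.
  by rewrite /q; field; exact: lt0r_neq0.
rewrite -Rintegral_affine//; apply: le_Rintegral => //.
- exact: integrable_itv.
- exact/integrable_itv/continuous_affine.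
- move=> x /=; rewrite in_itv /= => /convf fx.
  rewrite -(ler_pM2l ba0) (le_trans fx)// le_eqVlt; apply/orP; left; apply/eqP.
  by rewrite /q; field; exact: lt0r_neq0.
Qed.

Lemma Rintegral_itv_split f a b x : continuous f -> a <= x <= b ->
  \int[lebesgue_measure]_(y in `[a, b]) f y =
  \int[lebesgue_measure]_(y in `[a, x]) f y +
  \int[lebesgue_measure]_(y in `[x, b]) f y.
Proof.
move=> cf /andP[ax xb]; have intf := integrable_itv a b cf.
(* The point [x] is negligible, so the second integral may run over ]x, b]. *)
rewrite -[X in _ + X]Rintegral_itv_obnd_cbnd.
  by rewrite -(Rintegral_itvB intf) ?bnd_simp// addrC subrK.
apply: integrableS intf => //=.
by apply: subset_itvr; rewrite bnd_simp.
Qed.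

End RealIntegrals.

(** * Unit complex numbers *)

Section Expi.
Variable R : realType.
Implicit Type t : R.

Lemma normc_real (x : R) : Normc.normc x%:C = `|x|.
Proof. by rewrite /= expr0n /= addr0 sqrtr_sqr. Qed.

Lemma normc_expi t : Normc.normc (expi t) = 1.
Proof. by rewrite /= cos2Dsin2 sqrtr1. Qed.

Lemma conjc_expi t : Num.conj (expi t) = expi (- t).
Proof. by rewrite /expi cosN sinN. Qed.

Lemma expi0 : expi 0 = 1 :> R[i].
Proof. by rewrite /expi cos0 sin0. Qed.

Lemma expi_pihalf : expi (pi / 2) = 'i :> R[i].
Proof. by rewrite /expi cos_pihalf sin_pihalf. Qed.

Lemma expi_Npihalf : expi (- (pi / 2)) = - 'i :> R[i].
Proof. by rewrite -conjc_expi expi_pihalf conjCi. Qed.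

End Expi.

(** * Uniqueness and conjugate homogeneity of the adjoint *)

Section Adjoint.
Variables (R : realType) (H : hilbertType R).
Implicit Types (A B : bop H) (c : R[i]).

Let is_adjoint A : set (bop H) :=
  [set B | forall x y, inner (A x) y = inner x (B y)].

Lemma adjoint_unique A B B' : is_adjoint A B -> is_adjoint A B' -> B = B'.
Proof.
move=> AB AB'; apply: val_inj; apply/funext => y /=.
apply/eqP; rewrite -subr_eq0 -normr_eq0 -sqrf_eq0 sqr_norm_inner.
by rewrite linearBr /= -AB -AB' subrr.
Qed.

Lemma is_adjointZ c A B :
  is_adjoint A B -> is_adjoint (c *: A) (Num.conj c *: B).
Proof.
by move=> AB x y; rewrite /= linearZl_LR linearZr_LR /= conjCK AB.
Qed.

Lemma adjointZ c A : adjoint (c *: A) = Num.conj c *: adjoint A.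
Proof.
(* The zero operator is its own adjoint. Treating [c = 0] apart allows division by [c] in the last
   case, where an adjoint of [c *: A] would yield one of [A]. *)
have [->|c0] := eqVneq c 0.
  rewrite conjC0 !scale0r; apply: xget_unique => [x y|B adjB].
    by rewrite /= linear0l linear0r.
  by apply: adjoint_unique adjB _ => x y; rewrite /= linear0l linear0r.
have [[B AB]|noadj] := pselect (exists B, is_adjoint A B).
  have eqB : adjoint A = B.
    by apply: xget_unique => // B' AB'; exact: adjoint_unique AB' AB.
  rewrite eqB; apply: xget_unique; first exact: is_adjointZ.
  by move=> B' AB'; apply: adjoint_unique AB' (is_adjointZ c AB).
(* The junk value 0 of the adjoint is treated rather than excluded, so that
   Riesz' theorem is not needed. *)
rewrite /adjoint !xgetPN ?scaler0// => B AB; apply: noadj.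
- by exists B.
- exists (Num.conj c^-1 *: B).
  by have := is_adjointZ c^-1 AB; rewrite scalerA mulVf// scale1r.
Qed.

End Adjoint.

(** * The norm along an affine path of operators *)

Section NormPaths.
Variables (R : realType) (H : hilbertType R) (N : bop H -> R).
Hypothesis normN : is_norm N.
Implicit Types (A B U V : bop H) (a b l : R).

Lemma bop_normD A B : N (A + B) <= N A + N B.
Proof. by case: normN. Qed.

Lemma bop_normZ (c : R[i]) A : N (c *: A) = Normc.normc c * N A.
Proof.
case: normN => _ NZ _; have := NZ c A.
by rewrite -[`|c|]/((Normc.normc c)%:C) -rmorphM => -[].
Qed.

Lemma bop_normZr a A : N (a%:C *: A) = `|a| * N A.
Proof. by rewrite bop_normZ normc_real. Qed.

Lemma bop_normN A : N (- A) = N A.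
Proof. by rewrite -scaleN1r bop_normZ normcN Normc.normc1 mul1r. Qed.

Lemma bop_norm_ge0 A : 0 <= N A.
Proof.
have := bop_normD A (- A).
rewrite subrr bop_normN -(scale0r 0) bop_normZ Normc.normc0 mul0r; lra.
Qed.

(** Triangle inequality for the identity (b - a)(U + lV) = (b - l)(U + aV) + (l - a)(U + bV), whose
    coefficients are nonnegative. *)
Lemma path_convex U V a b l : a <= l <= b ->
  (b - a) * N (U + l%:C *: V) <=
  (b - l) * N (U + a%:C *: V) + (l - a) * N (U + b%:C *: V).
Proof.
move=> /andP[al lb].
have ba : 0 <= b - a by lra.
have bl : 0 <= b - l by lra.
have la : 0 <= l - a by lra.
rewrite -{1}(ger0_norm ba) -{1}(ger0_norm bl) -{1}(ger0_norm la) -!bop_normZr.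
apply: le_trans (bop_normD _ _); rewrite !scalerDr !scalerA -!rmorphM addrACA.
rewrite -!scalerDl -!rmorphD /=.
by rewrite (_ : b - l + (l - a) = b - a)
  1?(_ : (b - l) * a + (l - a) * b = (b - a) * l)//; ring.
Qed.

Lemma path_dist U V a b :
  `|N (U + a%:C *: V) - N (U + b%:C *: V)| <= `|a - b| * N V.
Proof.
wlog suff W : a b / N (U + a%:C *: V) - N (U + b%:C *: V) <= `|a - b| * N V.
  by rewrite ler_norml W lerNl opprB distrC W.
rewrite lerBlDl -bop_normZr; apply: le_trans (bop_normD _ _).
by rewrite -addrA -scalerDl -rmorphD/= [b + _]addrC subrK.
Qed.

Lemma continuous_path U V : continuous (fun l => N (U + l%:C *: V)).
Proof.
move=> l; apply/cvgrPdist_lt => e e0.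
(* The path is Lipschitz with constant [N V]; adding 1 allows division even when [V] is 0. *)
have V0 : 0 < N V + 1 by rewrite ltr_wpDl ?bop_norm_ge0.
near=> m.
apply: le_lt_trans (path_dist _ _ _ _) _.
apply: (@le_lt_trans _ _ (`|l - m| * (N V + 1))).
  by rewrite ler_wpM2l ?lerDl.
rewrite -ltr_pdivlMr//; near: m.
by apply: cvgr_dist_lt => //; rewrite divr_gt0.
Unshelve. all: by end_near. Qed.

End NormPaths.

(** * Bounds for the integral along a rotated path *)

Section RotatedPath.
Variables (R : realType) (H : hilbertType R) (N : bop H -> R).
Hypothesis normN : is_norm N.
Implicit Types (A B : bop H) (t l : R).

Let f A B t l := N (((1 - l)%:C * expi t) *: A + (l%:C * expi (- t)) *: B).

(** In the form U + lV, the path inherits the convexity and continuity shown for affine paths. *)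
Lemma rotated_pathE A B t l :
  f A B t l = N (expi t *: A + l%:C *: (expi (- t) *: B - expi t *: A)).
Proof.
rewrite /f; congr N; rewrite rmorphB mulrBl mul1r scalerBl scalerBr !scalerA.
by rewrite -addrA [- _ + _]addrC.
Qed.

Lemma continuous_rotated_path A B t : continuous (f A B t).
Proof.
by rewrite (funext (rotated_pathE A B t)); exact: continuous_path.
Qed.

Lemma Rintegral_rotated_path_le A B t :
  \int[lebesgue_measure]_(l in `[0, 1]) f A B t l <=
  N (2^-1 *: (expi t *: A + expi (- t) *: B)) / 2 + (N A + N B) / 4.
Proof.
have convf a b : a < b -> \int[lebesgue_measure]_(l in `[a, b]) f A B t l <=
    (b - a) * ((f A B t a + f A B t b) / 2).
  move=> ab; apply: Rintegral_trapezoid => // [|x].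
    exact: continuous_rotated_path.
  by rewrite !rotated_pathE; exact: path_convex.
(* Cutting at the midpoint gives it weight 1/2 and each endpoint weight 1/4; a single trapezoid on
   [0, 1] would not see the midpoint. *)
rewrite (@Rintegral_itv_split _ _ _ _ 2^-1); last 2 first.
- exact: continuous_rotated_path.
- by apply/andP; split; lra.
have f0 : f A B t 0 = N A.
  by rewrite /f subr0 mul0r mul1r scale0r addr0 bop_normZ// normc_expi mul1r.
have f1 : f A B t 1 = N B.
  by rewrite /f subrr mul0r mul1r scale0r add0r bop_normZ// normc_expi mul1r.
have fhalf : f A B t 2^-1 = N (2^-1 *: (expi t *: A + expi (- t) *: B)).
  rewrite /f (_ : 1 - 2^-1 = 2^-1); last by field.
  by rewrite scalerDr !scalerA fmorphV rmorph_nat.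
have := convf 0 2^-1; have := convf 2^-1 1.
rewrite f0 f1 fhalf => h1 h2.
have {}h1 := h1 ltac:(lra).
have {}h2 := h2 ltac:(lra).
lra.
Qed.

(* At the angles 0 and pi/2 the paths are, up to a unit factor, the sum and the
   difference of (1 - l) A and l B, whence the bound by their half-sum. *)
Lemma Rintegral_rotated_path_ge A B :
  (N A + N B) / 2 <=
  \int[lebesgue_measure]_(l in `[0, 1]) f A B 0 l +
  \int[lebesgue_measure]_(l in `[0, 1]) f A B (pi / 2) l.
Proof.
have cf t := @continuous_rotated_path A B t.
rewrite -RintegralD//; [|exact: integrable_itv..].
(* The half-sum is the integral of (1 - l) N(A) + l N(B), so a pointwise comparison suffices. *)
rewrite (_ : (N A + N B) / 2 =
    (1 - 0) * (N A + (N B - N A) * ((0 + 1) / 2))); last by field.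
rewrite -Rintegral_affine//; apply: le_Rintegral => //.
- exact/integrable_itv/continuous_affine.
- by apply: integrable_itv => l; apply: cvgD; exact: cf.
move=> l /=; rewrite in_itv /= => /andP[l0 l1].
set X := (1 - l)%:C *: A; set Y := l%:C *: B.
have NX : N X = (1 - l) * N A by rewrite bop_normZr// ger0_norm// subr_ge0.
have NY : N Y = l * N B by rewrite bop_normZr// ger0_norm.
have -> : f A B 0 l = N (X + Y) by rewrite /f oppr0 expi0 !mulr1.
have -> : f A B (pi / 2) l = N (X - Y).
  rewrite /f expi_pihalf expi_Npihalf mulrN scaleNr -!(mulrC 'i) -!scalerA.
  by rewrite -scalerBr bop_normZ// -expi_pihalf normc_expi mul1r.
have hX : N X + N X <= N (X + Y) + N (X - Y).
  have := bop_normD normN (X + Y) (X - Y).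
  rewrite addrACA subrr addr0 -mulr2n -scaler_nat bop_normZ//.
  by rewrite -(rmorph_nat (real_complex R)) normc_real ger0_norm//; lra.
have hY : N Y + N Y <= N (X + Y) + N (X - Y).
  have := bop_normD normN (X + Y) (- (X - Y)).
  rewrite bop_normN// opprB addrC addrA subrK.
  rewrite -mulr2n -scaler_nat bop_normZ//.
  by rewrite -(rmorph_nat (real_complex R)) normc_real ger0_norm//; lra.
(* The average of [hX] and [hY] has lower bound [N X + N Y], the value of the affine function at
   [l]. *)
lra.
Qed.

End RotatedPath.

(** * Passage to the suprema over all angles *)

Theorem theorem4p7 (R : realType) (H : hilbertType R)
    (sepH : separable_space H) (A : bop H) (N : bop H -> R)
    (normN : is_norm N) :
  0 <= 2 * sup (range (fun t : R =>
             \int[lebesgue_measure]_(l in `[0, 1])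
               N (((1 - l)%:C * expi t) *: A
                  + (l%:C * expi (- t)) *: adjoint A)))
         - 2^-1 * (N A + N (adjoint A))
    <= gen_numerical_radius N A.
Proof.
set B := adjoint A.
pose g t := \int[lebesgue_measure]_(l in `[0, 1])
  N (((1 - l)%:C * expi t) *: A + (l%:C * expi (- t)) *: B).
pose r t := N (Re_op (expi t *: A)).
have rE t : r t = N (2^-1 *: (expi t *: A + expi (- t) *: B)).
  by rewrite /r /Re_op adjointZ conjc_expi.
(* A bound uniform in [t] makes the supremum of [r] an actual upper bound; through [g_le] the same
   then holds for [g]. *)
have r_le t : r t <= (N A + N B) / 2.
  rewrite rE -(rmorph_nat (real_complex R)) -fmorphV bop_normZr//.
  have := bop_normD normN (expi t *: A) (expi (- t) *: B).
  by rewrite !bop_normZ// !normc_expi ger0_norm//; lra.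
have r_sup t : r t <= gen_numerical_radius N A.
  apply: ub_le_sup; last by exists t.
  by exists ((N A + N B) / 2) => _ [s _ <-]; exact: r_le.
have g_le t : g t <= r t / 2 + (N A + N B) / 4.
  by rewrite rE; exact: Rintegral_rotated_path_le.
have g_sup t : g t <= sup (range g).
  apply: ub_le_sup; last by exists t.
  exists (gen_numerical_radius N A / 2 + (N A + N B) / 4) => _ [s _ <-].
  by have := g_le s; have := r_sup s; lra.
have sup_g : sup (range g) <= gen_numerical_radius N A / 2 + (N A + N B) / 4.
  apply: ge_sup; first by exists (g 0), 0.
  by move=> _ [s _ <-]; have := g_le s; have := r_sup s; lra.
have g_ge : (N A + N B) / 2 <= g 0 + g (pi / 2).
  exact: Rintegral_rotated_path_ge.
(* Since [g 0 + g (pi / 2)] is at most twice the supremum of [g], [g_ge] gives nonnegativity;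
   doubling [sup_g] gives the upper estimate. *)
have := g_sup 0; have := g_sup (pi / 2).
change (range _) with (range g).
by move=> h1 h2; apply/andP; split; lra.
Qed.
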